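(* Let $d \geq 1$. For every real $\tau$ with $0 < \tau < \frac12$, there exists an injective map $\varphi \colon \mathbb{Z}^d \to \mathbb{R}^d$ with $\varphi(0)=0$ and $\sup_{a \in \mathbb{Z}^d}\|a-\varphi(a)\| \leq \tau$ such that for every integer $k \geq 1$ there exists a point $b_k \in \varphi(\mathbb{Z}^d)$ whose $k$-th Brillouin zone in $\varphi(\mathbb{Z}^d)$ contains a chamber with diameter at least $\tau$ and $d$-dimensional volume at least $\nu_d \left(\frac{\tau}{2}\right)^d$.
   Context: $\nu_d$ is the $d$-dimensional volume of the unit ball in $\mathbb{R}^d$. Let $P \subseteq \mathbb{R}^d$ be locally finite and $b \in P$. For $a \in P \setminus \{b\}$, the bisector of $b$ and $a$ is the hyperplane $\{x \in \mathbb{R}^d : \|x-b\| = \|x-a\|\}$. The chambers of the arrangement of these bisectors (for fixed $b$) are the closures of the connected components of the complement in $\mathbb{R}^d$ of the union of all bisectors. The $k$-th Brillouin zone of $b$ in $P$ is the set of $x \in \mathbb{R}^d$ such that $\|x-a\| < \|x-b\|$ for at most $k-1$ points $a \in P\setminus\{b\}$ and $\|x-a'\| \leq \|x-b\|$ for at least $k-1$ points $a' \in P \setminus\{b\}$; its chambers are those chambers of the arrangement whose interior points are separated from $b$ by exactly $k-1$ bisectors. *)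

(* Defs.v *)
From HB Require Import structures.
From mathcomp Require Import all_boot all_order all_algebra.
From mathcomp Require Import all_classical all_reals all_analysis.

Set Implicit Arguments.
Unset Strict Implicit.
Unset Printing Implicit Defensive.

Import Order.TTheory GRing.Theory Num.Theory.
Import numFieldNormedType.Exports.

Local Open Scope classical_set_scope.
Local Open Scope ring_scope.

(* The library norm `|x| on 'rV[R]_d is the sup norm, so the Euclidean norm is
   introduced here. Both induce the product topology, which is the library
   topology on 'rV[R]_d; closure, interior and connected components below are
   taken in it. *)
Definition enorm (R : realType) (d : nat) (x : 'rV[R]_d) : R :=
  Num.sqrt (\sum_(i < d) x ord0 i ^+ 2).

Definition lattice_point (R : realType) (d : nat) (a : 'rV[int]_d) : 'rV[R]_d :=
  \row_(i < d) (a ord0 i)%:~R.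

Definition diameter (R : realType) (d : nat) (C : set 'rV[R]_d) : \bar R :=
  ereal_sup [set (enorm (p.1 - p.2))%:E | p in C `*` C].

Definition box (R : realType) (d : nat) (q : 'rV[R]_d * 'rV[R]_d)
    : set 'rV[R]_d :=
  [set x | forall i, q.1 ord0 i <= x ord0 i <= q.2 ord0 i].

Definition box_volume (R : realType) (d : nat) (q : 'rV[R]_d * 'rV[R]_d) : R :=
  \prod_(i < d) (q.2 ord0 i - q.1 ord0 i).

(* d-dimensional Lebesgue (outer) measure: infimum of the total volume of a
   countable cover by axis-parallel boxes. It is the d-dimensional volume on
   Lebesgue measurable sets, in particular on closed sets. *)
Definition volume (R : realType) (d : nat) (A : set 'rV[R]_d) : \bar R :=
  ereal_inf [set (\sum_(0 <= n <oo) (box_volume (B n))%:E)%E | B in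
    [set B : nat -> 'rV[R]_d * 'rV[R]_d |
      (forall n i, (B n).1 ord0 i <= (B n).2 ord0 i) /\
      A `<=` \bigcup_n box (B n)]].

Definition unit_ball_volume (R : realType) (d : nat) : \bar R :=
  volume [set x : 'rV[R]_d | enorm x <= 1].

Definition bisector (R : realType) (d : nat) (b a : 'rV[R]_d) : set 'rV[R]_d :=
  [set x | enorm (x - b) = enorm (x - a)].

Definition bisectors (R : realType) (d : nat) (P : set 'rV[R]_d) (b : 'rV[R]_d)
    : set (set 'rV[R]_d) :=
  [set bisector b a | a in P `\ b].

Definition chamber (R : realType) (d : nat) (P : set 'rV[R]_d) (b : 'rV[R]_d)
    (C : set 'rV[R]_d) : Prop :=
  let U := ~` (\bigcup_(H in bisectors P b) H) in
  exists2 x, U x & C = closure (connected_component U x).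

Definition brillouin_zone (R : realType) (d : nat) (P : set 'rV[R]_d)
    (b : 'rV[R]_d) (k : nat) : set 'rV[R]_d :=
  [set x |
    ([set a | (P `\ b) a /\ enorm (x - a) < enorm (x - b)] #<= `I_k.-1)%card /\
    (`I_k.-1 #<= [set a | (P `\ b) a /\ enorm (x - a) <= enorm (x - b)])%card].

Definition separates (R : realType) (d : nat) (H : set 'rV[R]_d)
    (x y : 'rV[R]_d) : Prop :=
  [/\ ~ H x, ~ H y &
      exists t : R, 0 <= t <= 1 /\ H ((1 - t) *: x + t *: y)].

Definition brillouin_chamber (R : realType) (d : nat) (P : set 'rV[R]_d)
    (b : 'rV[R]_d) (k : nat) (C : set 'rV[R]_d) : Prop :=
  chamber P b C /\
  forall x, interior C x ->
    ([set H | bisectors P b H /\ separates H x b] #= `I_k.-1)%card.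

(* Main.v *)
Require Import Defs.
From HB Require Import structures.
From mathcomp Require Import all_boot all_order all_algebra.
From mathcomp Require Import all_classical all_reals all_analysis.
From mathcomp Require Import ring lra zify.

(** The construction makes every spherical shell that matters empty. Fix [n = k - 1]
    and a lattice point [c], let [near] be the [n] lattice points closest to [c]
    and [b] the next one, at distance [r] from [c]. Push every point of [near]
    radially towards [c] by [tau], every other point except [b] radially away
    from [c] by [tau], and leave [b] in place. Now no point other than [b] has
    its distance to [c] strictly between [r - tau] and [r + tau], so when [x]
    varies in the open ball of radius [tau / 2] around [c], the distance from
    [x] to [b] stays above the distance to each of the [n] near points and below
    the distance to each of the others ([ball_off_bisectors]). Hence no bisector
    of [b] meets this ball, which lies in a single chamber, separated from [b]
    by exactly the [n] bisectors of [b] with the near points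
    ([brillouin_chamber_at]). This chamber contains the closed ball of radius
    [tau / 2], which gives both the diameter and the volume.

    The displacements for different [n] do not interfere. The [n] nearest
    lattice points and the next one lie within distance [n] of [c], because of
    the multiples of a unit vector, so it is enough to displace the points of
    a slab of half-width [n + 1] around [c]: all others are at distance at least
    [n + 1 >= r + 1] and stay beyond [r + tau] after any motion by at most
    [tau < 1 / 2]. Centring these slabs at first coordinate [(n + 1) ^ 2] makes
    them disjoint, and keeps [0] out of all of them ([slab_inj], [slab0]). The
    map is injective because distinct lattice points are at distance at least
    [1 > 2 * tau].

    The side of a bisector is read off [gap a b], the difference of the squared
    distances to [a] and [b]: it is an affine function, so it varies linearly
    along segments, and a half-space where it is nonnegative has the strict
    half-space as interior. These two facts control the closures and interiors
    of the chambers, without any description of their faces. *)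

Set Implicit Arguments.
Unset Strict Implicit.
Unset Printing Implicit Defensive.

Import Order.TTheory GRing.Theory Num.Theory.
Import numFieldNormedType.Exports.

Local Open Scope classical_set_scope.
Local Open Scope ring_scope.

(** * Euclidean norm *)

Section Euclidean.
Variables (R : realType) (d : nat).
Implicit Types x y z a b c : 'rV[R]_d.

Definition dot x y : R := \sum_(i < d) x ord0 i * y ord0 i.

Lemma enorm_ge0 x : 0 <= enorm x.
Proof. exact: sqrtr_ge0. Qed.

Lemma sqr_enorm x : enorm x ^+ 2 = dot x x.
Proof.
rewrite /enorm sqr_sqrtr; last by apply: sumr_ge0 => i _; exact: sqr_ge0.
by apply: eq_bigr => i _; rewrite expr2.
Qed.

Lemma enorm_eq0 x : (enorm x == 0) = (x == 0).
Proof.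
apply/idP/eqP => [|->]; last first.
  by rewrite /enorm big1 ?sqrtr0// => i _; rewrite mxE expr0n.
rewrite -sqrf_eq0 sqr_enorm /dot psumr_eq0 => [/allP x0|i _]; last first.
  by rewrite -expr2 sqr_ge0.
apply/rowP => i; rewrite mxE.
by have /eqP := x0 i (mem_index_enum _); rewrite -expr2 => /eqP; rewrite sqrf_eq0 => /eqP.
Qed.

Lemma enorm_gt0 x : (0 < enorm x) = (x != 0).
Proof. by rewrite lt_def enorm_ge0 andbT enorm_eq0. Qed.

Lemma enormZ (t : R) x : enorm (t *: x) = `|t| * enorm x.
Proof.
rewrite -sqrtr_sqr /enorm -sqrtrM ?sqr_ge0//; congr Num.sqrt.
by rewrite mulr_sumr; apply: eq_bigr => i _; rewrite mxE exprMn.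
Qed.

Lemma enormN x : enorm (- x) = enorm x.
Proof. by rewrite -scaleN1r enormZ normrN1 mul1r. Qed.

Lemma enormC x y : enorm (x - y) = enorm (y - x).
Proof. by rewrite -enormN opprB. Qed.

Lemma sqr_enorm_lincomb (s t : R) x y :
  enorm (s *: x + t *: y) ^+ 2 =
    s ^+ 2 * enorm x ^+ 2 + 2 * s * t * dot x y + t ^+ 2 * enorm y ^+ 2.
Proof.
rewrite !sqr_enorm /dot !mulr_sumr -!big_split/=.
by apply: eq_bigr => i _; rewrite !mxE; ring.
Qed.

(** Cauchy-Schwarz, from the squared length of [|y| x - |x| y]. *)
Lemma dot_le x y : dot x y <= enorm x * enorm y.
Proof.
have [->|x0] := eqVneq x 0.
  rewrite /dot big1 ?mulr_ge0 ?enorm_ge0// => i _; first by rewrite mxE mul0r.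
have [->|y0] := eqVneq y 0.
  rewrite /dot big1 ?mulr_ge0 ?enorm_ge0// => i _; first by rewrite mxE mulr0.
have := sqr_ge0 (enorm (enorm y *: x + - enorm x *: y)).
rewrite sqr_enorm_lincomb.
have -> : enorm y ^+ 2 * enorm x ^+ 2 + 2 * enorm y * - enorm x * dot x y +
    (- enorm x) ^+ 2 * enorm y ^+ 2 =
  (2 * (enorm x * enorm y)) * (enorm x * enorm y - dot x y) by ring.
by rewrite pmulr_rge0 ?subr_ge0// !mulr_gt0 ?enorm_gt0.
Qed.

Lemma ler_enormD x y : enorm (x + y) <= enorm x + enorm y.
Proof.
rewrite -(@ler_pXn2r _ 2)// ?nnegrE ?addr_ge0 ?enorm_ge0//.
have := sqr_enorm_lincomb 1 1 x y; rewrite !scale1r => ->.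
by have := dot_le x y; lra.
Qed.

Lemma ler_enormB y x z : enorm (x - z) <= enorm (x - y) + enorm (y - z).
Proof. by apply: le_trans (ler_enormD _ _); rewrite addrA subrK. Qed.

Lemma ler_coord_enorm x (i : 'I_d) : `|x ord0 i| <= enorm x.
Proof.
rewrite -(@ler_pXn2r _ 2)// ?nnegrE ?enorm_ge0// sqr_enorm real_normK ?num_real//.
rewrite /dot (bigD1 i)//= expr2 lerDl sumr_ge0// => j _.
by rewrite -expr2 sqr_ge0.
Qed.

(** * The gap between squared distances *)

(** The power difference of [x] with respect to [a] and [b]; unlike the
    difference of the distances, it is affine in [x]. *)
Definition gap a b x : R := enorm (x - a) ^+ 2 - enorm (x - b) ^+ 2.

Lemma gapC a b x : gap b a x = - gap a b x.
Proof. by rewrite /gap opprB. Qed.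

Lemma gap_eq0 a b x : (gap a b x == 0) = (enorm (x - b) == enorm (x - a)).
Proof. by rewrite /gap subr_eq0 eqrXn2 ?enorm_ge0// eq_sym. Qed.

Lemma gap_gt0 a b x : (0 < gap a b x) = (enorm (x - b) < enorm (x - a)).
Proof. by rewrite subr_gt0 ltr_pXn2r// nnegrE enorm_ge0. Qed.

Lemma gap_lt0 a b x : (gap a b x < 0) = (enorm (x - a) < enorm (x - b)).
Proof. by rewrite -oppr_gt0 -gapC gap_gt0. Qed.

Lemma gap_ge0 a b x : (0 <= gap a b x) = (enorm (x - b) <= enorm (x - a)).
Proof. by rewrite subr_ge0 ler_pXn2r// nnegrE enorm_ge0. Qed.

Lemma gap_sum a b x :
  gap a b x = \sum_(i < d) (b ord0 i - a ord0 i) *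
                (2 * x ord0 i - a ord0 i - b ord0 i).
Proof.
rewrite /gap !sqr_enorm /dot -sumrB; apply: eq_bigr => i _; rewrite !mxE; ring.
Qed.

Lemma gap_segment a b (t : R) x y :
  gap a b ((1 - t) *: x + t *: y) = (1 - t) * gap a b x + t * gap a b y.
Proof.
rewrite !gap_sum !mulr_sumr -big_split/=; apply: eq_bigr => i _.
by rewrite !mxE; ring.
Qed.

Lemma gap_shift a b (t : R) x :
  gap a b (x + t *: (a - b)) = gap a b x - 2 * t * enorm (a - b) ^+ 2.
Proof.
rewrite !gap_sum sqr_enorm /dot mulr_sumr -sumrB; apply: eq_bigr => i _.
by rewrite !mxE; ring.
Qed.

Lemma continuous_gap a b : continuous (gap a b).
Proof.
rewrite (_ : gap a b = fun x => \sum_(i < d) (b ord0 i - a ord0 i) *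
                (2 * x ord0 i - a ord0 i - b ord0 i)); last first.
  by apply/funext => x; exact: gap_sum.
apply: (@continuous_big R) => [|i _ x]; first exact: (@add_continuous R).
apply: (@cvgM R _ (nbhs x)); first exact: cvg_cst.
do 2!(apply: (@cvgB R R _ (nbhs x)); last exact: cvg_cst).
apply: (@cvgM R _ (nbhs x)); first exact: cvg_cst.
exact: (@coord_continuous R 1 d ord0 i x).
Qed.

Lemma bisectorE a b : bisector b a = [set x | gap a b x = 0].
Proof.
by apply/seteqP; split=> x /= /eqP; [rewrite -gap_eq0|rewrite gap_eq0] => /eqP.
Qed.

(** The bisector of [b] and [a] contains the midpoint of [a] and [b]. If it is
    also the bisector of [b] and [a'], evaluating each gap at the midpoint of
    the other pair and adding gives [|a - a'| ^ 2 = 0]. *)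
Lemma bisector_inj b : {in ~` [set b] &, injective (bisector b)}.
Proof.
suff H a a' : bisector b a = bisector b a' -> enorm (a - a') ^+ 2 <= 0.
  move=> a a' _ _ /H; rewrite le_eqVlt ltNge sqr_ge0 orbF sqrf_eq0 enorm_eq0.
  by rewrite subr_eq0 => /eqP.
move=> e.
have m u : bisector b u (2^-1 *: (u + b)).
  rewrite bisectorE/= gap_sum big1// => i _; rewrite !mxE.
  by field.
have := m a; rewrite e bisectorE/= gap_sum => h.
have := m a'; rewrite -e bisectorE/= gap_sum => h'.
have := congr2 +%R h h'; rewrite addr0 -big_split/= => <-.
rewrite sqr_enorm le_eqVlt; apply/orP; left; apply/eqP.
by apply: eq_bigr => i _; rewrite !mxE; field.
Qed.

(** * Sides of bisectors *)

Lemma gap_closure a b (A : set 'rV[R]_d) :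
  (forall x, A x -> 0 <= gap a b x) -> forall x, closure A x -> 0 <= gap a b x.
Proof.
move=> A0 x Ax; rewrite leNgt; apply/negP => x0.
have [y [/A0]] := Ax _ (cvgr_lt _ (@continuous_gap a b x) _ x0).
by rewrite leNgt => /negP.
Qed.

Lemma continuous_line x y : continuous (fun t : R => x + t *: y).
Proof.
by move=> t; apply: cvgD; [exact: cvg_cst|apply: cvgZr_tmp; exact: cvg_id].
Qed.

(** Moving slightly from an interior point in the direction [a - b] stays in the set and
    decreases the gap strictly, so the gap cannot vanish there. *)
Lemma gap_interior a b (A : set 'rV[R]_d) : a != b ->
  (forall x, A x -> 0 <= gap a b x) -> forall x, interior A x -> 0 < gap a b x.
Proof.
move=> ab A0 x Ax.
have near0 : nbhs (0 : R) (fun t => A (x + t *: (a - b))).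
  by apply: (@continuous_line x (a - b) 0); rewrite scale0r addr0.
have [t [t0 /A0]] : exists t : R, 0 < t /\ A (x + t *: (a - b)).
  have : \forall t \near (0 : R)^'+, A (x + t *: (a - b)).
    by apply: cvg_within; exact: near0.
  by move=> /(filterI (nbhs_right_gt 0)) /filter_ex[t []]; exists t.
rewrite gap_shift subr_ge0; apply: lt_le_trans.
by rewrite !mulr_gt0 ?exprn_gt0// enorm_gt0 subr_eq0.
Qed.

(** Intermediate value theorem: a connected set that avoids a bisector stays on
    one side of it. *)
Lemma gap_connected a b (A : set 'rV[R]_d) c : connected A ->
  (forall x, A x -> gap a b x != 0) -> A c -> 0 < gap a b c ->
  forall x, A x -> 0 < gap a b x.
Proof.
move=> cA A0 Ac c0 x Ax; rewrite ltNge; apply/negP => x0.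
have /connected_intervalP img : connected (gap a b @` A).
  apply: connected_continuous_connected => //.
  by apply: continuous_subspaceT; exact: continuous_gap.
have [] := img (gap a b x) (gap a b c) _ _ 0; first by exists x.
- by exists c.
- by rewrite x0 ltW.
- by move=> y /A0 /eqP.
Qed.

End Euclidean.

(** * Chambers *)

Section Chambers.
Variables (R : realType) (d : nat) (P : set 'rV[R]_d) (b c : 'rV[R]_d).
Implicit Types x y a : 'rV[R]_d.

Definition off_bisectors : set 'rV[R]_d := ~` \bigcup_(H in bisectors P b) H.

Definition chamber_at : set 'rV[R]_d :=
  closure (connected_component off_bisectors c).

Definition closer : set 'rV[R]_d := [set a | (P `\ b) a /\ gap a b c < 0].

Lemma off_bisectorsP x :
  off_bisectors x <-> forall a, (P `\ b) a -> gap a b x != 0.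
Proof.
split=> [Ux a Pa|Ux [_ [a Pa <-]]]; last first.
  by rewrite bisectorE /=; apply/eqP; exact: Ux.
apply/eqP => ax0; apply: Ux; exists (bisector b a); first by exists a.
by rewrite bisectorE.
Qed.

Lemma gap_center x : gap x b b = enorm (b - x) ^+ 2.
Proof. by rewrite /gap subrr -(scale0r 0) enormZ normr0 mul0r expr0n subr0. Qed.

Section Side.
Hypothesis Uc : off_bisectors c.

Lemma chamber_far a x : (P `\ b) a -> 0 < gap a b c -> chamber_at x ->
  0 <= gap a b x.
Proof.
move=> Pa ac; apply: gap_closure => y Ky; apply/ltW.
apply: (gap_connected (@component_connected _ off_bisectors c) _ _ ac Ky).
  by move=> z /connected_component_sub /off_bisectorsP; exact.
exact: connected_component_refl.
Qed.

Lemma chamber_near a x : (P `\ b) a -> gap a b c < 0 -> chamber_at x ->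
  gap a b x <= 0.
Proof.
move=> Pa ac; rewrite -oppr_ge0 -gapC; apply: gap_closure => y Ky; apply/ltW.
have ca : 0 < gap b a c by rewrite gapC oppr_gt0.
apply: (gap_connected (@component_connected _ off_bisectors c) _ _ ca Ky).
  move=> z /connected_component_sub /off_bisectorsP.
  by rewrite gapC oppr_eq0; exact.
exact: connected_component_refl.
Qed.

Lemma interior_chamber_far a x : (P `\ b) a -> 0 < gap a b c ->
  interior chamber_at x -> 0 < gap a b x.
Proof.
move=> Pa ac; apply: gap_interior; first by apply/eqP; case: Pa.
by move=> y; exact: chamber_far.
Qed.

Lemma interior_chamber_near a x : (P `\ b) a -> gap a b c < 0 ->
  interior chamber_at x -> gap a b x < 0.
Proof.
move=> Pa ac; rewrite -oppr_gt0 -gapC; apply: gap_interior.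
  by rewrite eq_sym; apply/eqP; case: Pa.
by move=> y Cy; rewrite gapC oppr_ge0; exact: chamber_near.
Qed.

(** The gap is positive at [b]; being affine, it vanishes on the segment from
    [x] to [b] exactly when it is negative at [x], and the sign at [x] is the
    sign at [c]. *)
Lemma separates_chamber a x : (P `\ b) a -> interior chamber_at x ->
  separates (bisector b a) x b <-> gap a b c < 0.
Proof.
move=> Pa Cx; have [_ /eqP ab] := Pa.
have bb : 0 < gap a b b.
  by rewrite gap_center exprn_gt0// enorm_gt0 subr_eq0 eq_sym.
have /lt_total/orP[ac|ac] : gap a b c != 0 by move/off_bisectorsP: Uc; exact.
  have ax := interior_chamber_near Pa ac Cx.
  split=> // _; rewrite bisectorE; split=> /=.
  - by apply/eqP; rewrite lt_eqF.
  - by apply/eqP; rewrite gt_eqF.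
  (* The zero of the gap, which is affine along the segment. *)
  exists (gap a b x / (gap a b x - gap a b b)); rewrite gap_segment.
  have n0 : gap a b x - gap a b b < 0 by lra.
  split; last by field; rewrite lt_eqF.
  by rewrite ler_ndivlMr// ler_ndivrMr// mul0r mul1r; lra.
have ax := interior_chamber_far Pa ac Cx.
split=> [|/lt_trans/(_ ac)]; last by rewrite ltxx.
rewrite bisectorE => -[_ _ [t [/andP[t0 t1]]]] /=; rewrite gap_segment => e.
by nra.
Qed.

(** The separating bisectors are in bijection with the points closer to [c]
    than [b] is, so it suffices to count the latter. *)
Lemma brillouin_chamber_at k : (closer #= `I_k.-1)%card ->
  brillouin_chamber P b k chamber_at /\ chamber_at `<=` brillouin_zone P b k.
Proof.
move=> ck; split; first split.
- by exists c.
- move=> x Cx.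
  rewrite (_ : [set H | _] = bisector b @` closer).
    apply: card_eq_trans ck; apply: inj_card_eq.
    apply: sub_in2 (@bisector_inj R d b) => a; rewrite !inE.
    by case=> -[].
  apply/seteqP; split=> [_ [[a Pa <-]] /(separates_chamber Pa Cx) ac|].
    by exists a.
  by move=> _ [a [Pa ac] <-]; split; [exists a|apply/separates_chamber].
- move=> x Cx; split.
    rewrite -(card_le_eqr ck); apply: subset_card_le => a [Pa]; rewrite -gap_lt0 => ax; split=> //.
    rewrite ltNge; apply/negP => ac.
    have /(chamber_far Pa)/(_ Cx) : 0 < gap a b c.
      by rewrite lt_def ac andbT; move/off_bisectorsP: Uc; exact.
    by rewrite leNgt ax.
  rewrite -(card_le_eql ck); apply: subset_card_le => a [Pa ac]; split=> //.
  by rewrite -gap_ge0 gapC oppr_ge0; exact: chamber_near.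
Qed.

End Side.

(** No point of [P] other than [b] is at a distance from [c] that differs from
    that of [b] by less than [2 * s]; moving [c] by less than [s] changes each
    distance by less than [s], so the comparison with [b] is not affected. *)
Section Ball.
Variable s : R.
Hypothesis s0 : 0 < s.
Hypothesis gapped : forall a, (P `\ b) a ->
  enorm (c - a) + 2 * s <= enorm (c - b) \/
  enorm (c - b) + 2 * s <= enorm (c - a).

Lemma ball_off_bisectors x : enorm (x - c) < s -> off_bisectors x.
Proof.
move=> xc; apply/off_bisectorsP => a Pa; rewrite gap_eq0.
have := ler_enormB c x a; have := ler_enormB c x b.
have := ler_enormB x c a; have := ler_enormB x c b; rewrite (enormC c x).
by case: (gapped Pa) => *; apply/eqP; lra.
Qed.

Lemma ball_sub_component x : enorm (x - c) < s ->
  connected_component off_bisectors c x.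
Proof.
move=> xc; pose f (t : R) := c + t *: (x - c).
apply: (@connected_component_max _ _ (f @` [set t | 0 <= t <= 1])).
- by exists 0; rewrite /f/= ?lexx ?ler01// scale0r addr0.
- move=> _ [t /= /andP[t0 t1] <-]; apply: ball_off_bisectors.
  rewrite /f addrC addKr enormZ ger0_norm//.
  by apply: le_lt_trans xc; rewrite ler_piMl// enorm_ge0.
- apply: connected_continuous_connected.
    apply/connected_intervalP => u v /= /andP[u0 u1] /andP[v0 v1] w /andP[uw wv].
    by rewrite (le_trans u0)//= (le_trans wv).
  by apply: continuous_subspaceT => t; exact: continuous_line.
- by exists 1; rewrite /f/= ?lexx ?ler01// scale1r addrC subrK.
Qed.

(** Points of the sphere may lie on bisectors, but they are limits of points of
    the open ball along the radius. *)
Lemma closed_ball_sub_chamber x : enorm (x - c) <= s -> chamber_at x.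
Proof.
move=> xc B xB.
have near1 : nbhs (1 : R) (fun t => B (c + t *: (x - c))).
  by apply: (@continuous_line R d c (x - c) 1); rewrite scale1r addrC subrK.
have near1l : \forall t \near (1 : R)^'-, B (c + t *: (x - c)).
  by apply: cvg_within; exact: near1.
have /filter_ex[t [Bt [t1 t0]]] : \forall t \near (1 : R)^'-,
    B (c + t *: (x - c)) /\ (t < 1 /\ 0 < t).
  by apply: filterI => //; apply: filterI; [exact: nbhs_left_lt|exact: nbhs_left_gt].
exists (c + t *: (x - c)); split=> //.
apply: ball_sub_component; rewrite addrC addKr enormZ gtr0_norm//.
have [x0|x0] := eqVneq (enorm (x - c)) 0; first by rewrite x0 mulr0.
by apply: lt_le_trans xc; rewrite gtr_pMl// lt_def x0 enorm_ge0.
Qed.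

End Ball.
End Chambers.

(** * Diameter and volume of sets containing a ball *)

Section Size.
Variables (R : realType) (d : nat).
Implicit Types (A : set 'rV[R]_d) (c : 'rV[R]_d).

Lemma enorm_delta (i : 'I_d) : enorm (delta_mx ord0 i : 'rV[R]_d) = 1.
Proof.
rewrite /enorm (bigD1 i)//= big1 => [|j ji]; rewrite mxE eqxx/=.
  by rewrite eqxx expr1n addr0 sqrtr1.
by rewrite (negPf ji) expr0n.
Qed.

Lemma diameter_ball A c (s : R) : (0 < d)%N -> 0 <= s ->
  (forall x, enorm (x - c) <= s -> A x) -> ((2 * s)%:E <= diameter A)%E.
Proof.
move=> d0 s0 sA; pose e : 'rV[R]_d := delta_mx ord0 (Ordinal d0).
have Ae t : `|t| <= s -> A (c + t *: e).
  by move=> ts; apply: sA; rewrite addrC addKr enormZ enorm_delta mulr1.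
apply: ereal_sup_ubound; exists (c + s *: e, c + (- s) *: e) => /=.
  by split; apply: Ae; rewrite ?normrN ger0_norm.
rewrite opprD addrACA subrr add0r -scalerBl enormZ enorm_delta mulr1.
by rewrite opprK ger0_norm ?addr_ge0// mulrDl mul1r.
Qed.

(** A cover of [A] by boxes, rescaled by [x |-> (x - c) / s], is a cover of the
    unit ball, and the rescaling divides the volume of each box by [s ^+ d]. *)
Lemma volume_ball A c (s : R) : 0 < s ->
  (forall x, enorm (x - c) <= s -> A x) ->
  (unit_ball_volume R d * (s ^+ d)%:E <= volume A)%E.
Proof.
move=> s0 sA; apply: le_ereal_inf_tmp => _ [B [B0 AB] <-].
rewrite -lee_pdivlMr ?exprn_gt0// muleC.
have box_ge0 n : 0 <= box_volume (B n).
  by apply: prodr_ge0 => i _; rewrite subr_ge0.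
rewrite -nneseriesZl; last by move=> n _; rewrite lee_fin.
pose g (x : 'rV[R]_d) := s^-1 *: (x - c).
apply: ereal_inf_lbound; exists (fun n => (g (B n).1, g (B n).2)).
  split=> [n i|x /= x1]; first by rewrite !mxE ler_pM2l ?invr_gt0// lerD2r.
  have /sA/AB[n _ Bn] : enorm (c + s *: x - c) <= s.
    by rewrite addrC addKr enormZ gtr0_norm// ler_piMr// ltW.
  exists n => // i /=; rewrite !mxE ler_pdivrMl// ler_pdivlMl//.
  by have := Bn i; rewrite !mxE lerBlDl lerBrDl.
apply: eq_eseriesr => n _; rewrite -EFinM; congr EFin.
rewrite /box_volume -exprVn -[X in _ ^+ X]card_ord -prodr_const -big_split/=.
by apply: eq_bigr => i _; rewrite !mxE; ring.
Qed.

End Size.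

(** * Nearest lattice points *)

(** A weight with values in [nat] attains its minimum outside any finite set, so
    the points of least weight can be listed greedily. The injection [e] makes
    the type infinite, and bounds the index of a point outside a given list. *)
Section Nearest.
Variables (T : eqType) (N : T -> nat) (e : nat -> T).
Hypothesis e_inj : injective e.

Lemma fresh_index (s : seq T) : exists2 i, (i <= size s)%N & e i \notin s.
Proof.
case: (boolP (all (mem s) (map e (iota 0 (size s).+1)))) => [/allP sub|].
  have := uniq_leq_size _ sub; rewrite map_inj_uniq// iota_uniq => /(_ isT).
  by rewrite size_map size_iota ltnn.
move=> /allPn[y /mapP[i ilt ->] eis]; exists i => //.
by move: ilt; rewrite mem_iota.
Qed.

Lemma next_nearest (s : seq T) :
  exists2 b, b \notin s & forall y, y \notin s -> (N b <= N y)%N.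
Proof.
pose Q n := `[< exists2 y, y \notin s & N y = n >].
have exQ : exists n, Q n.
  have [i _ eis] := fresh_index s.
  by exists (N (e i)); apply/asboolP; exists (e i).
have [m Qm minb] := ex_minnP exQ.
move/asboolP: Qm => [b bs bm]; exists b => // y ys; rewrite bm.
by apply: minb; apply/asboolP; exists y.
Qed.

Lemma nearest n : exists s : seq T, [/\ uniq s, size s = n &
  forall x y, x \in s -> y \notin s -> (N x <= N y)%N].
Proof.
elim: n => [|n [s [us sn near]]]; first by exists [::].
have [b bs minb] := next_nearest s; exists (b :: s); split=> /=.
- by rewrite bs.
- by rewrite sn.
move=> x y; rewrite !inE negb_or => /predU1P[->|xs] /andP[_ ys].
  exact: minb.
exact: near.
Qed.

End Nearest.

Section Lattice.
Variables (R : realType) (d : nat) (i0 : 'I_d).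
Implicit Types a z : 'rV[int]_d.

Lemma lattice_pointB a z :
  lattice_point R (a - z) = lattice_point R a - lattice_point R z.
Proof. by apply/rowP => i; rewrite !mxE intrB. Qed.

(** The squared Euclidean length is a natural number: this is what makes a
    nearest lattice point exist. *)
Definition sqr_length a : nat := \sum_(i < d) `|a ord0 i|%N ^ 2.

Lemma sqr_lengthE a : enorm (lattice_point R a) ^+ 2 = (sqr_length a)%:R.
Proof.
rewrite sqr_enorm natr_sum; apply: eq_bigr => i _; rewrite mxE.
by rewrite -expr2 natrX natr_absz intr_norm real_normK ?num_real.
Qed.

Lemma ler_lattice a z : (enorm (lattice_point R a) <= enorm (lattice_point R z))
  = (sqr_length a <= sqr_length z)%N.
Proof.
by rewrite -(@ler_pXn2r _ 2)// ?nnegrE ?enorm_ge0// !sqr_lengthE ler_nat.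
Qed.

Lemma lattice_norm_ge1 a : a != 0 -> 1 <= enorm (lattice_point R a).
Proof.
move=> a0; rewrite -(@ler_pXn2r _ 2)// ?nnegrE ?enorm_ge0// sqr_lengthE expr1n.
rewrite ler1n lt0n; apply: contra a0; rewrite sum_nat_eq0 => /forallP/= a0.
apply/eqP/rowP => i; rewrite mxE; apply/eqP; have := a0 i.
by rewrite expn_eq0 absz_eq0 andbT.
Qed.

Definition axis_point (m : int) : 'rV[int]_d := m *: delta_mx ord0 i0.

(** The bound [n] on the last point comes from the [n + 1] points
    [0, e, 2 e, ..., n e] on the axis, one of which is not in the list. *)
Lemma nearest_lattice n : exists s : seq 'rV[int]_d * 'rV[int]_d,
  [/\ uniq s.1, size s.1 = n, s.2 \notin s.1,
      forall z, z \in s.1 -> enorm (lattice_point R z) <= enorm (lattice_point R s.2)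
    & (forall z, z \notin s.1 ->
        enorm (lattice_point R s.2) <= enorm (lattice_point R z)) /\
      enorm (lattice_point R s.2) <= n%:R].
Proof.
pose e (j : nat) := axis_point j.
have e_inj : injective e.
  move=> j k /rowP/(_ i0); rewrite !mxE !eqxx !mulr1 => -[]; exact.
have [s [us sn near]] := nearest sqr_length e_inj n.
have [b bs minb] := next_nearest sqr_length e_inj s.
exists (s, b); split=> //= [z zs|]; first by rewrite ler_lattice; exact: near.
split=> [z zs|]; first by rewrite ler_lattice; exact: minb.
have [j js /minb] := fresh_index e_inj s.
rewrite -ler_lattice => /le_trans; apply.
rewrite (_ : lattice_point R (e j) = j%:R *: delta_mx ord0 i0).
  by rewrite enormZ enorm_delta mulr1 ger0_norm// ler_nat -sn.
by apply/rowP => i; rewrite !mxE; case: (_ && _); rewrite ?mulr1 ?mulr0.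
Qed.

End Lattice.

(** * Emptying a spherical shell *)

Section Displacement.
Variables (R : realType) (d : nat) (tau : R).
Hypotheses (tau0 : 0 < tau) (tau1 : tau < 1 / 2).
Variables (near : seq 'rV[int]_d) (b : 'rV[int]_d).
Hypothesis b_far : b \notin near.
Hypothesis near_le : forall z, z \in near ->
  enorm (lattice_point R z) <= enorm (lattice_point R b).
Hypothesis far_ge : forall z, z \notin near ->
  enorm (lattice_point R b) <= enorm (lattice_point R z).
Implicit Types z : 'rV[int]_d.

(** Signed radial motion: outward when positive. *)
Definition radial_push z : R :=
  if z == b then 0 else if z \in near then - tau else tau.

Definition displacement z : 'rV[R]_d :=
  (radial_push z / enorm (lattice_point R z)) *: lattice_point R z.

Lemma displacement_le z : enorm (displacement z) <= tau.
Proof.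
have push_le : `|radial_push z| <= tau.
  rewrite /radial_push; case: eqP => _; first by rewrite normr0 ltW.
  by case: ifP => _; rewrite ?normrN gtr0_norm.
rewrite enormZ normrM normfV (ger0_norm (enorm_ge0 _)).
have [->|z0] := eqVneq (enorm (lattice_point R z)) 0.
  by rewrite mulr0 ltW.
by rewrite divfK.
Qed.

Lemma displacement_b : displacement b = 0.
Proof. by rewrite /displacement /radial_push eqxx mul0r scale0r. Qed.

Lemma enorm_displaced z : z != 0 ->
  enorm (lattice_point R z + displacement z) =
    enorm (lattice_point R z) + radial_push z.
Proof.
move=> /(lattice_norm_ge1 R) z1; rewrite /displacement -[X in X + _]scale1r.
rewrite -scalerDl enormZ -[X in _ * X](ger0_norm (enorm_ge0 _)) -normrM.
have -> : (1 + radial_push z / enorm (lattice_point R z)) *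
    enorm (lattice_point R z) = enorm (lattice_point R z) + radial_push z.
  by field; rewrite gt_eqF// (lt_le_trans ltr01).
have push_ge : - tau <= radial_push z.
  have := tau0; rewrite /radial_push.
  by case: eqP => _; [lra|case: ifP => _; lra].
by rewrite ger0_norm//; have := tau1; lra.
Qed.

(** The origin cannot move radially; but when it is one of the near points,
    [b] is a different lattice point, at distance at least [1 > tau]. *)
Lemma near_displaced z : z \in near ->
  enorm (lattice_point R z + displacement z) + tau <= enorm (lattice_point R b).
Proof.
move=> zn; have zb : z != b by apply: contraNneq b_far => <-.
have [z0|z0] := eqVneq z 0; last first.
  rewrite enorm_displaced// /radial_push (negPf zb) zn subrK.
  exact: near_le.
have lat0 : lattice_point R z = 0 by apply/rowP => i; rewrite z0 !mxE.
rewrite /displacement lat0 scaler0 addr0 (_ : enorm 0 = 0); last first.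
  by apply/eqP; rewrite enorm_eq0.
have : 1 <= enorm (lattice_point R b).
  by apply: lattice_norm_ge1; rewrite -z0 eq_sym.
by have := tau1; lra.
Qed.

(** Here the origin does not occur: it would force [b] to be at distance [0],
    hence to be the origin. *)
Lemma far_displaced z : z \notin near -> z != b ->
  enorm (lattice_point R b) + tau <= enorm (lattice_point R z + displacement z).
Proof.
move=> zn zb; have [z0|z0] := eqVneq z 0; last first.
  rewrite enorm_displaced// /radial_push (negPf zb) (negPf zn) lerD2r.
  exact: far_ge.
have := far_ge zn.
have -> : lattice_point R z = 0 by apply/rowP => i; rewrite z0 !mxE.
rewrite (_ : enorm 0 = 0); last by apply/eqP; rewrite enorm_eq0.
have : 1 <= enorm (lattice_point R b).
  by apply: lattice_norm_ge1; rewrite -z0 eq_sym.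
by lra.
Qed.

End Displacement.

(** * Assembling the zones *)

Section Slabs.
Variables (d : nat) (i0 : 'I_d).

Definition zone_center (n : nat) : 'rV[int]_d := axis_point i0 (n.+1 ^ 2)%N%:Z.

(** Whether a point moves for the sake of zone [n] depends on its first
    coordinate only: this makes disjointness a statement about integers. *)
Definition slab (n : nat) (a : 'rV[int]_d) : Prop :=
  `|(a - zone_center n) ord0 i0| < n.+1%:Z.

Lemma slabE n a : slab n a = (`|a ord0 i0 - (n.+1 ^ 2)%N%:Z| < n.+1%:Z) :> Prop.
Proof. by rewrite /slab !mxE !eqxx mulr1. Qed.

(** The slab [n] is cut out by [n * (n + 1) < x < (n + 1) * (n + 2)], and these
    intervals are consecutive. *)
Lemma slab_inj m n a : slab m a -> slab n a -> m = n.
Proof.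
rewrite !slabE; move: (a ord0 i0) => x hm hn.
have {}hm : (m * m.+1)%:Z < x /\ x < (m.+1 * m.+2)%:Z by nia.
have {}hn : (n * n.+1)%:Z < x /\ x < (n.+1 * n.+2)%:Z by nia.
by have [mn|nm|//] := ltngtP m n; nia.
Qed.

Lemma slab0 n : ~ slab n 0.
Proof. by rewrite slabE mxE; nia. Qed.

Lemma slab_ball (R : realType) n z :
  enorm (lattice_point R z) < n.+1%:R -> slab n (z + zone_center n).
Proof.
rewrite /slab addrK => zn; have := ler_coord_enorm (lattice_point R z) i0.
rewrite mxE -intr_norm => /le_lt_trans/(_ zn).
by rewrite -[n.+1%:R]/(n.+1%:Z%:~R) ltr_int.
Qed.

Lemma slabN (R : realType) n a : ~ slab n a ->
  n.+1%:R <= enorm (lattice_point R a - lattice_point R (zone_center n)).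
Proof.
move=> na; rewrite -lattice_pointB leNgt; apply/negP => /slab_ball.
by rewrite subrK.
Qed.

End Slabs.

Theorem theorem6p4 (R : realType) (d : nat) (hd : (0 < d)%N)
    (tau : R) (htau0 : 0 < tau) (htau1 : tau < 1 / 2) :
  exists phi : 'rV[int]_d -> 'rV[R]_d,
    [/\ injective phi,
        phi 0 = 0,
        (ereal_sup [set (enorm (lattice_point R a - phi a))%:E | a in [set: 'rV[int]_d]]
           <= tau%:E)%E &
        forall k : nat, (0 < k)%N ->
          exists2 b : 'rV[R]_d, range phi b &
          exists C : set 'rV[R]_d,
            [/\ brillouin_chamber (range phi) b k C,
                C `<=` brillouin_zone (range phi) b k,
                (tau%:E <= diameter C)%E &
                (unit_ball_volume R d * ((tau / 2) ^+ d)%:E <= volume C)%E]].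
Proof.
pose i0 := Ordinal hd.
have [sb sbP] := choice (nearest_lattice R i0).
pose shift n a := displacement tau (sb n).1 (sb n).2 (a - zone_center i0 n).
(* The index of the slab of a, or 0 when there is none. *)
pose idx a := xget 0%N [set n | slab i0 n a].
pose phi a := lattice_point R a +
  (if `[< slab i0 (idx a) a >] then shift (idx a) a else 0).
have phi_in n a : slab i0 n a -> phi a = lattice_point R a + shift n a.
  move=> na; have ia : slab i0 (idx a) a.
    by apply: (@xgetPex _ 0%N [set n | slab i0 n a]); exists n.
  by rewrite /phi (asboolT ia) (slab_inj ia na).
have phi_dist a : enorm (lattice_point R a - phi a) <= tau.
  rewrite opprD addrA subrr add0r enormN; case: ifP => _.
    exact: displacement_le.
  by rewrite (_ : enorm 0 = 0) ?ltW//; apply/eqP; rewrite enorm_eq0.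
have phi_rel n a : slab i0 n a -> phi a - lattice_point R (zone_center i0 n) =
    lattice_point R (a - zone_center i0 n) + shift n a.
  by move=> /phi_in ->; rewrite lattice_pointB addrAC.
have phi_inj : injective phi.
  move=> a a' e; apply/eqP; rewrite -subr_eq0; apply/negPn/negP.
  move=> /(lattice_norm_ge1 R); rewrite lattice_pointB.
  have := ler_enormB (phi a) (lattice_point R a) (lattice_point R a').
  have := phi_dist a; have := phi_dist a'; rewrite e (enormC (phi a')).
  by lra.
have phi0 : phi 0 = 0.
  rewrite /phi asboolF; last exact: slab0.
  by rewrite addr0; apply/rowP => i; rewrite !mxE.
(* From here on only the facts on phi collected above matter. *)
clearbody phi.
exists phi; split=> //.
- by apply: ge_ereal_sup => _ [a _ <-]; rewrite lee_fin.
(* Zone k lives around the center of slab k - 1, where site z is the image of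
   the lattice point at position z relative to this center. *)
move=> k k0; pose n := k.-1; pose c := lattice_point R (zone_center i0 n).
have [us sn b_far near_le [far_ge bn]] := sbP n.
set near := (sb n).1 in us sn b_far near_le far_ge.
set b := (sb n).2 in b_far near_le far_ge bn.
pose site z := phi (z + zone_center i0 n).
have slab_le z : enorm (lattice_point R z) <= enorm (lattice_point R b) ->
    slab i0 n (z + zone_center i0 n).
  move=> zb; apply: slab_ball; apply: le_lt_trans zb _.
  by apply: le_lt_trans bn _; rewrite ltr_nat.
have site_rel z : slab i0 n (z + zone_center i0 n) ->
    site z - c = lattice_point R z + displacement tau near b z.
  by move=> /phi_rel; rewrite /shift addrK.
have site_b : enorm (site b - c) = enorm (lattice_point R b).
  by rewrite site_rel ?displacement_b ?addr0//; exact: slab_le.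
have site_near z : z \in near -> enorm (site z - c) + tau <= enorm (site b - c).
  move=> zn; rewrite site_b site_rel; last by apply: slab_le; exact: near_le.
  exact: near_displaced.
have site_far z : z \notin near -> z != b ->
    enorm (site b - c) + tau <= enorm (site z - c).
  move=> zn zb; have [zs|zs] := pselect (slab i0 n (z + zone_center i0 n)).
    by rewrite site_b site_rel//; exact: far_displaced.
  (* A point outside slab n is at distance at least n + 1 >= |b| + 1, and has
     moved by at most tau; this uses 2 * tau < 1. *)
  have := slabN R zs; rewrite -/c site_b.
  have := ler_enormB (site z) (lattice_point R (z + zone_center i0 n)) c.
  have := phi_dist (z + zone_center i0 n); rewrite -/(site z).
  by move: bn; rewrite -natr1; lra.
have siteE a : phi a = site (a - zone_center i0 n) by rewrite /site subrK.
pose s := tau / 2; have s0 : 0 < s by rewrite divr_gt0.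
have s2 : 2 * s = tau by rewrite /s; field.
have gapped a : (range phi `\ site b) a ->
    enorm (c - a) + 2 * s <= enorm (c - site b) \/
    enorm (c - site b) + 2 * s <= enorm (c - a).
  rewrite s2 !(enormC c) => -[[{}a _ <-]]; rewrite siteE; move: (a - _) => z zb.
  have [zn|zn] := boolP (z \in near); [left; exact: site_near|right].
  by apply: site_far => //; apply/eqP => e; apply: zb; rewrite e.
exists (site b); first by exists (b + zone_center i0 n).
exists (chamber_at (range phi) (site b) c).
have ball_in x : enorm (x - c) <= s -> chamber_at (range phi) (site b) c x.
  exact: closed_ball_sub_chamber.
have Uc : off_bisectors (range phi) (site b) c.
  apply: (ball_off_bisectors gapped).
  by rewrite subrr (_ : enorm 0 = 0)//; apply/eqP; rewrite enorm_eq0.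
have closerE : closer (range phi) (site b) c = site @` [set` near].
  apply/seteqP; split=> [_ [[[a _ <-] ab]]|_ [z zn <-]].
    rewrite gap_lt0 !(enormC c) siteE => lt_b; exists (a - zone_center i0 n) => //=.
    apply: contraPT lt_b => zn; apply/negP; rewrite -leNgt.
    have : a - zone_center i0 n != b.
      by apply/eqP => e; apply: ab; rewrite siteE e.
    by move=> /(site_far _ zn); lra.
  have lt_b := site_near z zn.
  split; last by rewrite gap_lt0 !(enormC c); lra.
  by split; [exists (z + zone_center i0 n)|move=> e; move: lt_b; rewrite e; lra].
have card_closer : (closer (range phi) (site b) c #= `I_k.-1)%card.
  rewrite closerE; apply: (card_eq_trans (B := [set` near])).
    by apply: inj_card_eq => x y _ _ /phi_inj /addIr.
  have -> : [set` near] = nth b near @` `I_n.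
    apply/seteqP; split=> [z /= /(nthP b)[i ilt <-]|_ [i /= ilt <-]].
      by exists i => //=; rewrite -sn.
    by rewrite /= mem_nth// sn.
  apply: inj_card_eq => i j; rewrite !inE/= => ilt jlt /eqP.
  by rewrite nth_uniq ?sn// => /eqP.
have [bc bz] := brillouin_chamber_at Uc card_closer.
split=> //; first by rewrite -s2; apply: diameter_ball ball_in => //; exact: ltW.
exact: volume_ball ball_in.
Qed.
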